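(* Let $G$ be a loopless graph. Then the following are equivalent: the neighbourhood-set system $(V(G),\mathcal{N}(G))$ is extremal; the neighbourhood-set system $(V(G),\mathcal{N}(G))$ is well-graded; $G$ is either a nonempty set of isolated vertices or a union of some disjoint half-graphs and a nonempty set of isolated vertices.
   Context: Graphs are finite, undirected, with nonempty vertex set and no multiple edges. $N_G(v)$ is the set of vertices adjacent to $v$, and $\mathcal{N}(G)=\{N_G(v):v\in V(G)\}$ (without multiplicities). An isolated vertex is a vertex of degree $0$. A set system $(X,\mathcal{F})$ is a finite set $X$ with a nonempty family $\mathcal{F}$ of distinct subsets of $X$. Its one-inclusion graph $G_{\mathcal{F}}$ has a vertex $v_A$ for each $A\in\mathcal{F}$, with an edge (directed from $v_A$ to $v_B$, labelled $b$) whenever $B=A\cup\{b\}$ for some $b\in X\setminus A$. The system is well-graded if for all $A,B\in\mathcal{F}$ the distance between $v_A$ and $v_B$ in the underlying undirected graph of $G_{\mathcal{F}}$ equals $|A\triangle B|$ (infinite distance if there is no path). $Y\subseteq X$ is shattered if $\{A\cap Y:A\in\mathcal{F}\}$ is the full power set of $Y$; it is strongly shattered if there is $T\subseteq X\setminus Y$ with $\{Z\cup T:Z\subseteq Y\}\subseteq\mathcal{F}$. The system is extremal if the shattered and strongly shattered sets coincide. The half-graph of order $n\ge 1$ is a bipartite graph with parts $\{a_1,\dots,a_n\}$ and $\{b_1,\dots,b_n\}$ such that either for all $1\le i,j\le n$, $a_i$ is adjacent to $b_j$ iff $i\le j$, or for all $1\le i,j\le n$, $a_i$ is adjacent to $b_j$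 iff $i\ge j$. A ''union of disjoint half-graphs and isolated vertices'' is a disjoint union, with no edges between different pieces; the half-graphs may have different orders. *)

(* Defs.v *)
From mathcomp Require Import all_boot.
Set Implicit Arguments.
Unset Strict Implicit.
Unset Printing Implicit Defensive.

Section SetSystems.
Variables (X : finType) (F : {set {set X}}).

Definition shattered (Y : {set X}) : bool :=
  [set A :&: Y | A in F] == powerset Y.

Definition strongly_shattered (Y : {set X}) : bool :=
  [exists T : {set X},
     (T \subset ~: Y) && ([set Z :|: T | Z in powerset Y] \subset F)].

Definition extremal : Prop :=
  forall Y : {set X}, shattered Y = strongly_shattered Y.

(* The arc from A to B labelled b. *)
Definition labelled_arc (b : X) (A B : {set X}) : bool :=
  (b \notin A) && (B == b |: A).

Definition one_inclusion_arc : rel {A : {set X} | A \in F} :=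
  fun u v => [exists b, labelled_arc b (val u) (val v)].

Definition one_inclusion_edge : rel {A : {set X} | A \in F} :=
  fun u v => one_inclusion_arc u v || one_inclusion_arc v u.

End SetSystems.

(* [distance_is e x y n] fails for every n when no path joins x to y
   (infinite distance). *)
Definition distance_is (T : eqType) (e : rel T) (x y : T) (n : nat) : Prop :=
  (exists p : seq T, [/\ path e x p, last x p = y & size p = n]) /\
  (forall p : seq T, path e x p -> last x p = y -> n <= size p).

Definition symdiff (X : finType) (A B : {set X}) : {set X} :=
  (A :\: B) :|: (B :\: A).

Definition well_graded (X : finType) (F : {set {set X}}) : Prop :=
  forall u v : {A : {set X} | A \in F},
    distance_is (@one_inclusion_edge X F) u v #|symdiff (val u) (val v)|.

Section Graphs.
Variables (V : finType) (e : rel V).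

Definition neighbourhood (v : V) : {set V} := [set u | e v u].

Definition neighbourhoods : {set {set V}} := [set neighbourhood v | v : V].

Lemma neighbourhoods_neq0 : 0 < #|V| -> neighbourhoods != set0.
Proof.
by case/card_gt0P=> v _; apply/set0Pn; exists (neighbourhood v); apply: imset_f.
Qed.

Definition isolated (v : V) : bool := #|neighbourhood v| == 0.

(* The subgraph induced on H is a half-graph; indices run over 0, ..., n - 1
   instead of 1, ..., n. *)
Definition half_graph_on (H : {set V}) : Prop :=
  exists (n : nat) (a b : 'I_n -> V),
    [/\ 0 < n,
        [/\ injective a, injective b & forall i j, a i != b j],
        H = [set a i | i : 'I_n] :|: [set b j | j : 'I_n],
        forall i j, ~~ e (a i) (a j) /\ ~~ e (b i) (b j)
      & (forall i j, e (a i) (b j) = (i <= j)) \/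
        (forall i j, e (a i) (b j) = (i >= j))].

Definition nonempty_isolated (I : {set V}) : Prop :=
  I != set0 /\ {in I, forall v, isolated v}.

(* P is the family of vertex sets of the half-graphs. No edge joins a piece
   of P to I because vertices of I are isolated in the whole graph. *)
Definition half_graphs_and_isolated : Prop :=
  exists (P : {set {set V}}) (I : {set V}),
    [/\ P != set0 /\ {in P, forall H, half_graph_on H},
        nonempty_isolated I,
        [/\ trivIset P, [disjoint cover P & I] & cover P :|: I = [set: V]]
      & forall H K : {set V}, H \in P -> K \in P -> H != K ->
          {in H & K, forall x y, ~~ e x y}].

End Graphs.

(* Main.v *)
(* Well-gradedness amounts to a local condition: if A <> B are in F, some
   z in symdiff A B has symdiff A {z} in F. For an extremal F, Pajor's inequality
   |F| <= #shattered sets is an equality; this passes to subcubes, and a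
   subcube containing exactly two members of F forces them to be adjacent.

   For a well-graded neighbourhood system, labels and neighbourhoods are both
   indexed by vertices, and counting them shows that the one-inclusion graph
   is a tree rooted at the empty set in which every non-isolated vertex labels
   exactly one arc. Let lam w be the label of the arc entering N(w). Then
   u ~ lam w iff N(w) is contained in N(u); the symmetry of adjacency makes
   lam an inclusion-reversing involution, so that comparability of
   neighbourhoods is an equivalence relation whose classes are chains, and
   each chain C spans a half-graph with lam(C).

   For half-graphs with isolated vertices, two vertices with a common neighbour
   have nested neighbourhoods, so no pair of vertices is shattered. *)
Require Import Defs.
From mathcomp Require Import all_boot.
From mathcomp Require Import zify.
Set Implicit Arguments.
Unset Strict Implicit.
Unset Printing Implicit Defensive.

(** * Symmetric differences and flipping one point *)

Section SymmetricDifference.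
Variable X : finType.
Implicit Types (A B C D : {set X}) (x z : X).

Lemma in_symdiff A B x : (x \in symdiff A B) = (x \in A) (+) (x \in B).
Proof. by rewrite !inE; case: (x \in A); case: (x \in B). Qed.

Lemma symdiff_eq0 A B : (symdiff A B == set0) = (A == B).
Proof.
apply/eqP/eqP => [AB0|->]; last by apply/setP=> x; rewrite in_symdiff addbb inE.
apply/setP=> x; have := in_symdiff A B x; rewrite AB0 inE.
by case: (x \in A); case: (x \in B).
Qed.

Lemma symdiffKl A B : symdiff A (symdiff A B) = B.
Proof. by apply/setP=> x; rewrite !in_symdiff addbA addbb. Qed.

Lemma symdiff0 A : symdiff A set0 = A.
Proof. by apply/setP=> x; rewrite in_symdiff inE addbF. Qed.

Lemma card_symdiff_triangle A B C :
  #|symdiff A C| <= #|symdiff A B| + #|symdiff B C|.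
Proof.
apply: leq_trans (leq_card_setU _ _).
apply/subset_leq_card/subsetP=> x; rewrite in_setU !in_symdiff.
by case: (x \in A); case: (x \in B); case: (x \in C).
Qed.

Lemma symdiff_flip_in A B z : z \in symdiff A B ->
  symdiff (symdiff A [set z]) B = symdiff A B :\ z.
Proof.
move=> zAB; apply/setP=> x; rewrite in_setD1 !in_symdiff in_set1.
have [->|_] := eqVneq x z; last by rewrite addbF.
by move: zAB; rewrite in_symdiff; case: (z \in A); case: (z \in B).
Qed.

Lemma symdiff_flip_notin A B z : z \notin symdiff A B ->
  symdiff (symdiff A [set z]) B = z |: symdiff A B.
Proof.
move=> zAB; apply/setP=> x; rewrite in_setU1 !in_symdiff in_set1.
have [->|_] := eqVneq x z; last by rewrite addbF.
by move: zAB; rewrite in_symdiff; case: (z \in A); case: (z \in B).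
Qed.

End SymmetricDifference.

(** * Well-gradedness as a local condition, and labels of arcs *)

Section OneInclusionGraph.
Variables (X : finType) (F : {set {set X}}).
Implicit Types (A B C : {set X}) (x z : X).

Definition locally_graded :=
  forall A B, A \in F -> B \in F -> A != B ->
  exists2 z, z \in symdiff A B & symdiff A [set z] \in F.

(** Flipping the membership of [z] is its own inverse, so a single formula covers both directions of
    an arc. *)
Lemma one_inclusion_edgeP (u v : {A : {set X} | A \in F}) :
  reflect (exists z, val v = symdiff (val u) [set z]) (one_inclusion_edge u v).
Proof.
rewrite /one_inclusion_edge /one_inclusion_arc; apply: (iffP orP).
  case=> /existsP[z /andP[zA /eqP vuz]]; exists z; apply/setP=> x;
    rewrite in_symdiff vuz in_setU1 in_set1;
    by have [->|] := eqVneq x z; rewrite ?(negPf zA) ?addbF.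
case=> z vE; case zu: (z \in val u).
  right; apply/existsP; exists z; rewrite /labelled_arc vE in_symdiff zu set11 /=.
  apply/eqP/setP=> x; rewrite in_setU1 in_symdiff in_set1.
  by have [->|] := eqVneq x z; rewrite ?addbF.
left; apply/existsP; exists z; rewrite /labelled_arc zu vE /=.
apply/eqP/setP=> x; rewrite in_setU1 in_symdiff in_set1.
by have [->|] := eqVneq x z; rewrite ?addbF ?zu.
Qed.

(** The first step of a shortest path from [A] to [B] flips some [z]. If [z] were outside
    [symdiff A B], the rest of the path would be shorter than the distance that remains. *)
Lemma well_graded_locally : well_graded F -> locally_graded.
Proof.
move=> wgF A B AF BF neqAB.
have [[[|w p] [pathp lastp sizep]] _] := wgF (exist _ A AF) (exist _ B BF).
  by move/esym/eqP: sizep; rewrite /= cards_eq0 symdiff_eq0 (negPf neqAB).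
case/andP: pathp => /one_inclusion_edgeP[z /= wE] pathp.
exists z; last by rewrite -wE; apply: valP.
apply/negPn/negP=> zAB.
have := (wgF w (exist _ B BF)).2 p pathp lastp; rewrite /=.
rewrite wE symdiff_flip_notin // cardsU1 zAB.
by move: sizep => /= <-; rewrite add1n ltnNge leqnSn.
Qed.

(** Each edge changes the symmetric difference by at most one point, which bounds path lengths from
    below; repeatedly flipping the point supplied by the local condition reaches the bound. *)
Lemma locally_well_graded : locally_graded -> well_graded F.
Proof.
move=> lgF u v; split; last first.
  move=> p; elim: p u => [|w p IHp] u /=.
    by move=> _ ->; rewrite leqn0 cards_eq0 symdiff_eq0.
  case/andP=> /one_inclusion_edgeP[z wE] pathp lastp.
  apply: leq_trans (card_symdiff_triangle _ (val w) _) _.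
  by rewrite {1}wE symdiffKl cards1 add1n ltnS IHp.
move: {2}#|_| (erefl #|symdiff (val u) (val v)|) => n.
elim: n u => [|n IHn] u duv.
  exists [::]; split=> //.
  by apply/val_inj/eqP; rewrite -symdiff_eq0 -cards_eq0 duv.
have [|z zuv uzF] := lgF _ _ (valP u) (valP v).
  by rewrite -symdiff_eq0 -cards_eq0 duv.
have dwv : #|symdiff (symdiff (val u) [set z]) (val v)| = n.
  by rewrite symdiff_flip_in //; move: duv; rewrite (cardsD1 z) zuv => -[].
pose w : {A : {set X} | A \in F} := exist _ (symdiff (val u) [set z]) uzF.
have [p [pathp lastp sizep]] := IHn w dwv.
exists (w :: p); split=> //; last by rewrite duv -dwv -sizep.
by rewrite /= pathp andbT; apply/one_inclusion_edgeP; exists z.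
Qed.

(* Among the members of [F] that differ from [A0] at [x], one nearest to [A0]
   can only be moved towards [A0] by flipping [x], so [h] sends it to [x]. *)
Lemma label_cover A0 (h : {set X} -> X) (D : {set X}) :
    locally_graded -> A0 \in F ->
    (forall A, A \in F -> A != A0 ->
       h A \in symdiff A A0 /\ symdiff A [set h A] \in F) ->
    (forall x, x \in D -> exists2 A, A \in F & x \in symdiff A A0) ->
  D \subset h @: (F :\ A0).
Proof.
move=> lgF A0F hP DP; apply/subsetP=> x /DP[A1 A1F xA1].
pose Q A := (A \in F) && (x \in symdiff A A0).
have QA1 : Q A1 by rewrite /Q A1F.
case: (arg_minnP (fun A => #|symdiff A A0|) QA1) => A /andP[AF xA] minA.
have neqA : A != A0 by apply: contraTneq xA => ->; rewrite in_symdiff addbb.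
have [hA hAF] := hP A AF neqA.
apply/imsetP; exists A; first by rewrite in_setD1 neqA.
apply/eqP/negPn/negP=> neqx.
have := minA (symdiff A [set h A]); rewrite /Q hAF symdiff_flip_in //.
by rewrite in_setD1 neqx xA => /(_ isT); rewrite (cardsD1 (h A)) hA ltnn.
Qed.

Lemma label_exists A0 : locally_graded -> A0 \in F -> 0 < #|X| ->
  exists h : {set X} -> X, forall A, A \in F -> A != A0 ->
    h A \in symdiff A A0 /\ symdiff A [set h A] \in F.
Proof.
move=> lgF A0F /card_gt0P[x0 _].
(* The default [x0] is returned only when no flip towards [A0] stays in [F], which the local
   condition excludes for members other than [A0]. *)
exists (fun A => odflt x0 [pick z in symdiff A A0 | symdiff A [set z] \in F]).
move=> A AF neqA; case: pickP => [z /andP[]|no] //=.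
by have [z zA zF] := lgF A A0 AF A0F neqA; have := no z; rewrite zA zF.
Qed.

End OneInclusionGraph.

(** * Pajor's inequality and extremal systems *)

Section Extremal.
Variable X : finType.
Implicit Types (F : {set {set X}}) (A B C Y Z : {set X}) (x z : X).

Lemma shatteredP F Y :
  reflect (forall Z, Z \subset Y -> exists2 A, A \in F & A :&: Y = Z)
          (shattered F Y).
Proof.
apply: (iffP eqP) => [shY Z ZY|shY].
  by move: ZY; rewrite -powersetE -shY => /imsetP[A AF ->]; exists A.
apply/setP=> Z; rewrite powersetE; apply/imsetP/idP => [[A _ ->]|/shY[A AF <-]].
  exact: subsetIr.
by exists A.
Qed.

Lemma strongly_shatteredP F Y :
  reflect (exists2 T : {set X}, T \subset ~: Y &
             forall Z, Z \subset Y -> Z :|: T \in F)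
          (strongly_shattered F Y).
Proof.
apply: (iffP existsP) => [[T /andP[TY /subsetP sF]]|[T TY sF]]; exists T => //.
  by move=> Z ZY; apply: sF; apply: imset_f; rewrite powersetE.
rewrite TY; apply/subsetP=> _ /imsetP[Z ZY ->].
by apply: sF; rewrite -powersetE.
Qed.

Lemma strongly_shattered_shattered F Y :
  strongly_shattered F Y -> shattered F Y.
Proof.
case/strongly_shatteredP=> T TY sF; apply/shatteredP=> Z ZY.
exists (Z :|: T); first exact: sF.
rewrite setIUl (setIidPl ZY) [T :&: Y](_ : _ = set0) ?setU0 //.
by apply/eqP; rewrite setI_eq0 disjoints_subset.
Qed.

Definition shattered_sets F : {set {set X}} := [set Y | shattered F Y].

Definition slice F x (b : bool) : {set {set X}} := [set A in F | (x \in A) == b].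

Lemma slice_sub F x b : slice F x b \subset F.
Proof. by apply/subsetP=> ?; rewrite inE => /andP[]. Qed.

Lemma card_slices F x : #|slice F x true| + #|slice F x false| = #|F|.
Proof.
rewrite -(cardsID [set A : {set X} | x \in A] F); congr (_ + _);
  by apply: eq_card => A; rewrite !inE; case: (x \in A); rewrite ?andbT ?andbF.
Qed.

Lemma shatteredS F (G : {set {set X}}) Y : F \subset G -> shattered F Y -> shattered G Y.
Proof.
move=> /subsetP FG /shatteredP shY; apply/shatteredP=> Z /shY[A AF <-].
by exists A; rewrite ?FG.
Qed.

Lemma slice_shattered_notin F x b Y : shattered (slice F x b) Y -> x \notin Y.
Proof.
move=> /shatteredP shY; apply/negP=> xY.
have xb Z : Z \subset Y -> (x \in Z) = b.
  by case/shY=> A + <-; rewrite inE => /andP[_ /eqP <-]; rewrite inE xY andbT.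
have := xb set0 (sub0set Y); rewrite -(xb [set x]) ?sub1set //.
by rewrite set11 inE.
Qed.

(** To realise a trace [Z], choose the slice according to whether [x \in Z] and realise [Z :&: Y]
    there. *)
Lemma slices_shattered F x Y :
  shattered (slice F x true) Y -> shattered (slice F x false) Y ->
  shattered F (x |: Y).
Proof.
move=> sh1 sh0; have xY := slice_shattered_notin sh0.
have shb b : shattered (slice F x b) Y by case: b.
apply/shatteredP=> Z ZxY; have /shatteredP/(_ (Z :&: Y) (subsetIr _ _)) := shb (x \in Z).
case=> A; rewrite inE => /andP[AF /eqP xA] AY; exists A => //.
apply/setP=> y; rewrite in_setI in_setU1.
have [->|neqyx] /= := eqVneq y x; first by rewrite andbT.
have := congr1 (fun C : {set X} => y \in C) AY; rewrite /= !in_setI => ->.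
by case yZ: (y \in Z) => //=; have := subsetP ZxY y yZ; rewrite in_setU1 (negPf neqyx).
Qed.

(** A set [Y] shattered by both slices is counted twice on the left, and pays for it with the two
    shattered sets [Y] and [x |: Y]. The latter is new, since no set shattered by a slice contains
    [x]. *)
Lemma card_shattered_slices F x :
  #|shattered_sets (slice F x true)| + #|shattered_sets (slice F x false)|
    <= #|shattered_sets F|.
Proof.
set S1 := shattered_sets _; set S0 := shattered_sets _.
have notx b Y : Y \in shattered_sets (slice F x b) -> x \notin Y.
  by rewrite inE; apply: slice_shattered_notin.
rewrite -cardsUI -(card_in_imset (f := fun Y => x |: Y) (D := S1 :&: S0)); last first.
  move=> Y Z /setIP[/notx xY _] /setIP[/notx xZ _] /= YZ.
  by rewrite -(setU1K xY) YZ setU1K.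
rewrite -cardsUI; set S := (fun Y => x |: Y) @: _.
have -> : (S1 :|: S0) :&: S = set0.
  apply/setP=> Y; rewrite [RHS]inE; apply/negbTE/negP=> /setIP[YS /imsetP[Z _ YE]].
  by case/setUP: YS => /notx; rewrite YE setU11.
rewrite cards0 addn0.
apply/subset_leq_card; rewrite subUset; apply/andP; split.
  by rewrite subUset; apply/andP; split; apply/subsetP=> Y; rewrite !inE;
    apply: shatteredS; apply: slice_sub.
apply/subsetP=> _ /imsetP[Y + ->]; rewrite !inE => /andP[].
exact: slices_shattered.
Qed.

(** Induction on [#|F|]: slicing at a point where two members differ gives two strictly smaller
    families. *)
Lemma pajor F : #|F| <= #|shattered_sets F|.
Proof.
have [n] := ubnP #|F|; elim: n F => // n IHn F; rewrite ltnS => leFn.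
have [F0|[A AF]] := set_0Vmem F; first by rewrite F0 cards0.
have [FA|] := boolP (F \subset [set A]).
  apply: leq_trans (subset_leq_card FA) _; rewrite cards1.
  apply/card_gt0P; exists set0; rewrite inE; apply/shatteredP=> Z.
  by rewrite subset0 => /eqP->; exists A; rewrite ?setI0.
case/subsetPn=> B BF; rewrite inE -symdiff_eq0 => /set0Pn[x].
rewrite in_symdiff => xBA.
have ltA : #|slice F x (x \in A)| > 0.
  by apply/card_gt0P; exists A; rewrite inE AF eqxx.
have ltB : #|slice F x (x \in B)| > 0.
  by apply/card_gt0P; exists B; rewrite inE BF eqxx.
have [lt1 lt0] : #|slice F x true| > 0 /\ #|slice F x false| > 0.
  by move: xBA ltA ltB; case: (x \in A); case: (x \in B).
have cF := card_slices F x.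
apply: leq_trans (card_shattered_slices F x).
by rewrite -cF; apply: leq_add; apply: IHn; lia.
Qed.

(* [Y] is strongly shattered by [F] only if its complement is not shattered by
   the complement of [F], so Pajor's bound for the latter applies. *)
Lemma card_strongly_shattered F : #|[set Y | strongly_shattered F Y]| <= #|F|.
Proof.
rewrite -(card_imset _ (@setC_inj X)).
apply: (@leq_trans #|~: shattered_sets (~: F)|).
  apply/subset_leq_card/subsetP=> _ /imsetP[Y + ->].
  rewrite !inE => /strongly_shatteredP[T TY sF].
  apply/negP=> /shatteredP/(_ T TY)[A]; rewrite inE => /negP AF AT; apply: AF.
  by rewrite -(setID A Y) setDE AT; apply: sF; apply: subsetIr.
have := pajor (~: F); have := cardsC F; have := cardsC (shattered_sets (~: F)).
lia.
Qed.

Lemma extremal_card F : extremal F -> #|shattered_sets F| <= #|F|.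
Proof.
move=> exF; apply: leq_trans (card_strongly_shattered F).
by apply/subset_leq_card/subsetP=> Y; rewrite !inE exF.
Qed.

(** Pajor's bounds for the two slices add up to at most the bound for [F], so equality for [F]
    forces equality for each slice. *)
Lemma tight_slice F x b : #|shattered_sets F| <= #|F| ->
  #|shattered_sets (slice F x b)| <= #|slice F x b|.
Proof.
have := card_shattered_slices F x; have := card_slices F x.
have := pajor (slice F x true); have := pajor (slice F x false).
by case: b; lia.
Qed.

(** The subcube through [A] with free directions [S] is cut out by one slice for each coordinate
    outside [S]. *)
Lemma tight_subcube F A (S : {set X}) : #|shattered_sets F| <= #|F| ->
  #|shattered_sets [set C in F | symdiff A C \subset S]|
    <= #|[set C in F | symdiff A C \subset S]|.
Proof.
move=> tF; have [n] := ubnP #|~: S|; elim: n S => // n IHn S; rewrite ltnS => leSn.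
have [S0|[x xS]] := set_0Vmem (~: S).
  suff -> : [set C in F | symdiff A C \subset S] = F by [].
  apply/setP=> C; rewrite inE; have -> : S = setT by rewrite -[S]setCK S0 setC0.
  by rewrite subsetT andbT.
have xS' : x \notin S by rewrite inE in xS.
suff -> : [set C in F | symdiff A C \subset S] =
          slice [set C in F | symdiff A C \subset x |: S] x (x \in A).
  apply: tight_slice; apply: IHn; apply: leq_trans leSn.
  rewrite (cardsD1 x (~: S)) xS add1n ltnS; apply/subset_leq_card/subsetP=> y.
  by rewrite !inE negb_or.
apply/setP=> C; rewrite !inE -andbA; case: (C \in F) => //=.
apply/subsetP/andP => [sS|[/subsetP sS /eqP xC] y yAC].
  split; first by apply/subsetP=> y /sS yS; rewrite in_setU1 yS orbT.
  have := sS x; rewrite in_symdiff (negPf xS').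
  by case: (x \in A); case: (x \in C) => //= /(_ isT).
have := sS y yAC; rewrite in_setU1 => /orP[/eqP yx|//].
by move: yAC; rewrite yx in_symdiff xC addbb.
Qed.

Lemma extremal_locally_graded F : extremal F -> locally_graded F.
Proof.
move=> /extremal_card tF A B AF BF neqAB.
(* [C] is chosen nearest to [A] in the subcube spanned by [A] and [B], so that the subcube spanned
   by [A] and [C] meets [F] in these two sets only. *)
pose Q C := [&& C \in F, C != A & symdiff A C \subset symdiff A B].
have QB : Q B by rewrite /Q BF eq_sym neqAB subxx.
case: (arg_minnP (fun C => #|symdiff A C|) QB) => C /and3P[CF neqCA sACB] minC.
have cubeE : [set D in F | symdiff A D \subset symdiff A C] = [set A; C].
  apply/setP=> D; rewrite !inE; apply/andP/orP => [[DF sD]|[]/eqP->]; last first.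
  - by rewrite CF subxx.
  - by rewrite AF (eqP (_ : symdiff A A == set0)) ?sub0set // symdiff_eq0.
  have [|neqDA] := eqVneq D A; [by left|right].
  have leCD : #|symdiff A C| <= #|symdiff A D|.
    by apply: minC; rewrite /Q DF neqDA (subset_trans sD).
  have /eqP eqD : symdiff A D == symdiff A C by rewrite eqEcard sD.
  by rewrite -(symdiffKl A D) eqD symdiffKl.
have := tight_subcube A (symdiff A C) tF; rewrite cubeE cards2 => leSh.
have neqAC : symdiff A C != set0 by rewrite symdiff_eq0 eq_sym.
have [z zAC] := set0Pn _ neqAC.
have sh1 y : y \in symdiff A C -> [set y] \in shattered_sets [set A; C].
  move=> yAC; rewrite inE; apply/shatteredP=> Z.
  have inI D : D :&: [set y] = if y \in D then [set y] else set0.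
    apply/setP=> t; rewrite !inE; case: ifP => yD; rewrite ?inE;
    by have [->|] := eqVneq t y; rewrite ?yD ?andbF.
  rewrite subset1 => ZE.
  have [yZ|yZ] : Z = [set y] \/ Z = set0 by case/orP: ZE => /eqP; auto.
    move: yAC; rewrite in_symdiff; case yA: (y \in A) => /= yC.
      by exists A; rewrite ?set21 // inI yA.
    by exists C; rewrite ?set22 // inI yC.
  move: yAC; rewrite in_symdiff; case yA: (y \in A) => /= yC.
    by exists C; rewrite ?set22 // inI (negPf yC).
  by exists A; rewrite ?set21 // inI yA.
have sh0 : set0 \in shattered_sets [set A; C].
  rewrite inE; apply/shatteredP=> Z; rewrite subset0 => /eqP->.
  by exists A; rewrite ?set21 ?setI0.
exists z; first by apply: subsetP zAC.
suff <- : symdiff A C = [set z] by rewrite symdiffKl.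
apply/setP=> y; rewrite in_set1; apply/idP/eqP => [yAC|->//].
apply/eqP/negPn/negP=> neqyz.
(* Two points in [symdiff A C] would give three shattered sets, while tightness allows only two. *)
have : #|[set set0; [set y]; [set z]]| <= #|shattered_sets [set A; C]|.
  by apply/subset_leq_card/subsetP=> D; rewrite !inE -orbA => /or3P[]/eqP->;
    have := sh0; have := sh1 y yAC; have := sh1 z zAC; rewrite !inE.
rewrite -setUA cardsU1 cards2 !inE negb_or.
have s0 t : (set0 == [set t]) = false.
  by apply/negbTE; rewrite eq_sym; apply/set0Pn; exists t; rewrite set11.
have -> : ([set y] != [set z]) by apply: contra neqyz => /eqP/set1_inj->.
by rewrite !s0 /=; move/leq_trans=> /(_ _ leSh); case: (A != C).
Qed.

End Extremal.

(** * From locally graded neighbourhoods to half-graphs *)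

Section LocallyGradedNeighbourhoods.
Variables (V : finType) (e : rel V).
Hypotheses (V_nonempty : 0 < #|V|) (e_sym : symmetric e)
  (e_loopless : irreflexive e).
Hypothesis lgN : locally_graded (neighbourhoods e).
Implicit Types u v w x y z : V.
Notation N := (neighbourhood e).

Lemma in_neighbourhood u v : (u \in N v) = e v u.
Proof. by rewrite inE. Qed.

Lemma neighbourhood_in v : N v \in neighbourhoods e.
Proof. exact: imset_f. Qed.

Let W : {set V} := [set v | ~~ isolated e v].

Lemma non_isolatedP v : reflect (exists u, e v u) (v \in W).
Proof.
rewrite inE /isolated cards_eq0; apply: (iffP (set0Pn _)) => -[u uv];
  by exists u; rewrite inE in uv *.
Qed.

Lemma edge_non_isolated u v : e u v -> (u \in W) && (v \in W).
Proof.
move=> euv; apply/andP; split; apply/non_isolatedP; first by exists v.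
by exists u; rewrite e_sym.
Qed.

(* Without isolated vertices every vertex is a label, but there are fewer than
   [#|V|] neighbourhoods other than a given one. *)
Lemma isolated_exists : set0 \in neighbourhoods e.
Proof.
apply/negPn/negP=> no0.
have WT v : v \in W.
  rewrite inE /isolated cards_eq0; apply: contra no0 => /eqP <-.
  exact: neighbourhood_in.
have [v0 _] := card_gt0P V_nonempty.
have [h hP] := label_exists lgN (neighbourhood_in v0) V_nonempty.
have /subset_leq_card : [set: V] \subset h @: (neighbourhoods e :\ N v0).
  apply: (label_cover lgN (neighbourhood_in v0) hP) => x _; have /non_isolatedP[u exu] := WT x.
  (* Some neighbourhood differs from [N v0] at [x]: [N x] omits [x] by looplessness, and [N u]
     contains it. *)
  case xv0: (x \in N v0); [exists (N x)|exists (N u)];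
    rewrite ?neighbourhood_in // in_symdiff xv0 in_neighbourhood.
    by rewrite e_loopless.
  by rewrite e_sym exu.
rewrite cardsT => /leq_trans/(_ (leq_imset_card _ _)).
have := leq_imset_card N [set: V]; rewrite cardsT.
have -> : N @: [set: V] = neighbourhoods e.
  by apply/setP=> A; apply/imsetP/imsetP => -[x _ ->]; exists x.
rewrite (cardsD1 (N v0)) neighbourhood_in => le1 le2.
by have := leq_trans le1 le2; rewrite add1n ltnn.
Qed.

(* [lam w] is the label of the only arc of the one-inclusion graph that enters
   [N w]: this graph is a tree rooted at [set0] with pairwise distinct labels. *)
Lemma matching_exists : exists lam : V -> V,
  [/\ {in W, forall w, e w (lam w)},
      {in W &, injective lam},
      {in W &, injective N},
      lam @: W = W &
      {in W, forall w, N w :\ lam w \in neighbourhoods e /\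
                       forall u, e u (lam w) = (N w \subset N u)}].
Proof.
have N0 := isolated_exists.
have [h hP] := label_exists lgN N0 V_nonempty.
have sd0 (A : {set V}) : symdiff A set0 = A := symdiff0 A.
have flip (A : {set V}) z : z \in A -> symdiff A [set z] = A :\ z.
  by move=> zA; rewrite -{2}[A]sd0 -symdiff_flip_in ?sd0.
have hA A : A \in neighbourhoods e -> A != set0 ->
    h A \in A /\ A :\ h A \in neighbourhoods e.
  by move=> AF A0; have [] := hP A AF A0; rewrite sd0 => hA; rewrite flip.
have WN w : w \in W -> N w != set0 by rewrite inE /isolated cards_eq0.
have coverW : W \subset h @: (neighbourhoods e :\ set0).
  apply: (label_cover lgN N0 hP) => x /non_isolatedP[u exu].
  by exists (N u); rewrite ?neighbourhood_in // sd0 in_neighbourhood e_sym.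
have nbW : neighbourhoods e :\ set0 = N @: W.
  apply/setP=> A; rewrite in_setD1; apply/andP/imsetP.
    case=> A0 /imsetP[w _ AE]; exists w => //.
    by rewrite inE /isolated cards_eq0 -AE.
  by case=> w /WN Nw ->; rewrite neighbourhood_in.
(* The cardinalities run in a circle from [#|W|] back to [#|W|], so all are equal, and both [h] and
   [N] are injective on the relevant sets. *)
have le1 := subset_leq_card coverW.
have le2 : #|h @: (neighbourhoods e :\ set0)| <= #|neighbourhoods e :\ set0|.
  exact: leq_imset_card.
have le3 : #|neighbourhoods e :\ set0| <= #|W| by rewrite nbW leq_imset_card.
have h_inj : {in neighbourhoods e :\ set0 &, injective h}.
  by apply/imset_injP; rewrite eqn_leq le2 (leq_trans le3).
have N_inj : {in W &, injective N}.
  by apply/imset_injP; rewrite -nbW eqn_leq le3 (leq_trans le1).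
have NW w : w \in W -> N w \in neighbourhoods e :\ set0.
  by move=> wW; rewrite nbW imset_f.
exists (h \o N).
have lamE w : w \in W -> e w (h (N w)).
  by move=> wW; have [] := hA _ (neighbourhood_in w) (WN _ wW);
    rewrite in_neighbourhood.
split=> //.
- move=> w w' wW w'W /= hE; apply: N_inj => //; apply: h_inj => //; exact: NW.
- rewrite imset_comp -nbW; apply/esym/eqP; rewrite eqEsubset coverW /=.
  rewrite nbW -imset_comp; apply/subsetP=> _ /imsetP[w wW ->] /=.
  by case/andP: (edge_non_isolated (lamE w wW)).
move=> w wW /=; have Nw := neighbourhood_in w.
split; first by have [] := hA _ Nw (WN _ wW).
move=> u; apply/idP/idP => [eul|/subsetP/(_ (h (N w)))]; last first.
  by rewrite !in_neighbourhood; apply; apply: lamE.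
(* A smallest neighbourhood inside N u containing the label of N w has that
   same label, hence is N w. *)
pose Q A := [&& A \in neighbourhoods e, A \subset N u & h (N w) \in A].
have Qu : Q (N u) by rewrite /Q neighbourhood_in subxx in_neighbourhood.
case: (arg_minnP (fun A : {set V} => #|A|) Qu) => A /and3P[AF AU hwA] minA.
have A0 : A != set0 by apply/set0Pn; exists (h (N w)).
have [hAA AhF] := hA A AF A0.
suff -> : N w = A by [].
apply: h_inj; rewrite ?NW ?in_setD1 ?A0 //.
apply/eqP/negPn/negP=> neqh.
have := minA (A :\ h A); rewrite /Q AhF (subset_trans (subD1set _ _)) //.
by rewrite in_setD1 neqh hwA => /(_ isT); rewrite (cardsD1 (h A) A) hAA ltnn.
Qed.

Let le u v := N u \subset N v.
Let comp u v := le u v || le v u.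

Lemma lg_half_graphs : W != set0 -> half_graphs_and_isolated e.
Proof.
move=> W_neq0.
have [lam [lamE lam_inj N_inj lamW lamP]] := matching_exists.
have lamIn w : w \in W -> lam w \in W by move=> wW; rewrite -lamW imset_f.
have lam_onto w : w \in W -> exists2 v, v \in W & w = lam v.
  by rewrite -{1}lamW => /imsetP.
have lam_le u w : w \in W -> e u (lam w) = le w u.
  by move=> wW; have [_] := lamP w wW; apply.
have le_trans : transitive le by move=> v u w; apply: subset_trans.
have le_refl u : le u u by apply: subxx.
have lam_anti u v : u \in W -> v \in W -> le (lam u) (lam v) = le v u.
  move=> uW vW; apply/subsetP/idP => [sub|levu].
    by rewrite -lam_le // e_sym -in_neighbourhood sub // in_neighbourhood e_sym lam_le.
  move=> w; rewrite !in_neighbourhood !(e_sym _ w) !lam_le //.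
  exact: le_trans.
(* Every [a] in [W] is some [lam b], and both comparisons reduce to adjacency of [lam u] and
   [lam b]. Hence [lam (lam u)] and [u] lie below the same vertices of [W]. *)
have lamK u : u \in W -> lam (lam u) = u.
  move=> uW; apply: N_inj; rewrite ?lamIn //.
  have key a : a \in W -> le (lam (lam u)) a = le u a.
    move=> aW; have [b bW ->] := lam_onto a aW.
    by rewrite lam_anti ?lamIn // -lam_le // e_sym lam_le.
  by apply/eqP; rewrite eqEsubset; apply/andP; split;
    [rewrite -/(le _ _) key|rewrite -/(le _ _) -key ?lamIn].
(* Descent on [N u]: removing [lam u] leaves a neighbourhood [N p]. If [N v] and [N w] both omit
   [lam u], then [p] replaces [u]; if one contains it, that one contains [N u] and hence the
   other. *)
have le_chain u v w : v \in W -> w \in W -> le v u -> le w u -> comp v w.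
  move=> vW wW; have [n] := ubnP #|N u|; elim: n u => // n IHn u leun lvu lwu.
  have uW : u \in W.
    case/non_isolatedP: vW => x evx; apply/non_isolatedP; exists x.
    by rewrite -in_neighbourhood (subsetP lvu) // in_neighbourhood.
  have [/imsetP[p _ pE] _] := lamP u uW.
  have [vl|vl] := boolP (lam u \in N v).
    by rewrite in_neighbourhood lam_le // in vl; rewrite /comp (le_trans _ _ _ lwu vl) orbT.
  have [wl|wl] := boolP (lam u \in N w).
    by rewrite in_neighbourhood lam_le // in wl; rewrite /comp (le_trans _ _ _ lvu wl).
  apply: (IHn p); rewrite /le -?pE ?subsetD1 ?vl ?wl ?andbT //.
  by move: leun; rewrite (cardsD1 (lam u) (N u)) in_neighbourhood lamE.
have compC u v : comp u v = comp v u by rewrite /comp orbC.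
have comp_lam u v : u \in W -> v \in W -> comp (lam u) (lam v) = comp u v.
  by move=> uW vW; rewrite /comp !lam_anti // orbC.
have ge_chain u v w : u \in W -> v \in W -> w \in W ->
    le u v -> le u w -> comp v w.
  move=> uW vW wW luv luw; rewrite -comp_lam //.
  by apply: (le_chain (lam u)); rewrite ?lamIn ?lam_anti.
have comp_trans u v w : u \in W -> v \in W -> w \in W ->
    comp u v -> comp v w -> comp u w.
  move=> uW vW wW /orP[uv|vu] /orP[vw|wv].
  - by rewrite /comp (le_trans _ _ _ uv vw).
  - exact: (le_chain v).
  - exact: (ge_chain v).
  - by rewrite /comp (le_trans _ _ _ wv vu) orbT.
have edge_ncomp u v : e u v -> ~~ comp u v.
  move=> euv; apply/negP=> /orP[/subsetP/(_ v)|/subsetP/(_ u)];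
    by rewrite !in_neighbourhood e_loopless ?(e_sym v) euv => /(_ isT).
(* A class of [R] is a comparability class together with its image under [lam]. *)
pose R u v := comp u v || comp u (lam v).
have R_equiv : {in W & &, equivalence_rel R}.
  have Rsym x y : x \in W -> y \in W -> R x y = R y x.
    move=> xW yW; rewrite /R [comp y x]compC [comp y _]compC -[in RHS](lamK y) //.
    by rewrite comp_lam ?lamIn ?lamK.
  have Rtrans x y z : x \in W -> y \in W -> z \in W -> R x y -> R y z -> R x z.
    move=> xW yW zW /orP[xy|xy] /orP[yz|yz]; apply/orP.
    - by left; apply: comp_trans yz.
    - by right; apply: comp_trans yz; rewrite ?lamIn.
    - right; apply: comp_trans xy _; rewrite ?lamIn //.
      by rewrite comp_lam.
    - left; apply: comp_trans xy _; rewrite ?lamIn //.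
      by rewrite -(lamK z) // comp_lam ?lamIn.
  move=> x y z xW yW zW; split; first by rewrite /R /comp le_refl.
  move=> xy; apply/idP/idP; last exact: Rtrans.
  by apply: Rtrans; rewrite // Rsym.
have edgeR u v : e u v -> R u v.
  move=> euv; have /andP[uW vW] := edge_non_isolated euv.
  by move: euv; rewrite -{1}(lamK v) // lam_le ?lamIn // /R /comp => ->; rewrite !orbT.
pose P := equivalence_partition R W.
have /and3P[/eqP coverP trivP P0] := equivalence_partitionP R_equiv.
exists P, (~: W); split.
- split; first by apply: contraNneq W_neq0 => PE; rewrite -coverP -/P PE /cover big_set0.
  move=> _ /imsetP[u uW ->].
  (* The chain of [u], sorted by inclusion of neighbourhoods, is one side of the half-graph; its
     image under [lam] is the other. *)
  pose A := [set v in W | comp u v].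
  pose s := sort le (enum A).
  have s_mem v : (v \in s) = (v \in W) && comp u v by rewrite mem_sort mem_enum inE.
  have s_uniq : uniq s by rewrite sort_uniq enum_uniq.
  have s_comp v w : v \in s -> w \in s -> comp v w.
    rewrite !s_mem => /andP[vW uv] /andP[wW uw].
    by apply: comp_trans uw; rewrite // compC.
  have s_sorted : sorted le s.
    apply: (sort_sorted_in (P := mem A)).
      move=> v w vA wA; apply: s_comp; rewrite s_mem;
      by [move: vA; rewrite inE|move: wA; rewrite inE].
    by apply/allP=> v; rewrite mem_enum.
  pose a (i : 'I_(size s)) := nth u s i.
  have a_mem i : a i \in s by apply: mem_nth.
  have aW i : a i \in W by have := a_mem i; rewrite s_mem => /andP[].
  have a_inj : injective a.
    by move=> i j /eqP; rewrite nth_uniq // => /eqP/val_inj.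
  have le_a i j : le (a i) (a j) = (i <= j).
    have le_nth k l : k <= l -> l < size s -> le (nth u s k) (nth u s l).
      by move=> kl ls; apply: sorted_leq_nth; rewrite ?inE ?(leq_ltn_trans kl).
    apply/idP/idP => [lij|lij]; last exact: le_nth.
    rewrite leqNgt; apply/negP=> ltji.
    have lji : le (a j) (a i) by apply: le_nth => //; apply: ltnW.
    have aE : a i = a j by apply: N_inj => //; apply/eqP; rewrite eqEsubset; apply/andP.
    by move: ltji; rewrite (a_inj _ _ aE) ltnn.
  exists (size s), a, (lam \o a); split.
  - by rewrite lt0n size_eq0; apply/eqP=> s0;
      have := s_mem u; rewrite s0 uW /comp le_refl.
  - split=> // [i j /= /lam_inj E|i j /=]; first by apply: a_inj; apply: E.
    apply/eqP=> aE; have := edge_ncomp _ _ (lamE (a j) (aW j)).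
    by rewrite -aE s_comp.
  - apply/setP=> v; rewrite inE in_setU; apply/andP/orP.
      case=> vW /orP[uv|uv]; [left|right]; apply/imsetP.
        have vs : v \in s by rewrite s_mem vW.
        by exists (Ordinal (etrans (index_mem v s) vs)); rewrite // /a nth_index.
      have vs : lam v \in s by rewrite s_mem lamIn.
      exists (Ordinal (etrans (index_mem (lam v) s) vs)) => //.
      by rewrite /= /a nth_index // lamK.
    case=> /imsetP[i _ ->]; have := a_mem i; rewrite s_mem => /andP[aiW uai].
      by rewrite aiW /R uai.
    by rewrite lamIn // /R lamK // uai orbT.
  - move=> i j; split; first by apply: contraTN (s_comp _ _ (a_mem i) (a_mem j)) => /edge_ncomp.
    apply: contraTN (s_comp _ _ (a_mem i) (a_mem j)) => /edge_ncomp.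
    by rewrite comp_lam.
  - by right=> i j; rewrite /= lam_le // le_a.
- split; last by move=> v; rewrite !inE negbK.
  have /imsetP[v _ v0] := isolated_exists; apply/set0Pn; exists v.
  by rewrite !inE negbK /isolated -v0 cards0.
- split=> //; first by rewrite coverP disjoints_subset setCK.
  by rewrite coverP setUCr.
move=> _ _ /imsetP[u uW ->] /imsetP[v vW ->] neqHK x y.
rewrite !inE => /andP[xW ux] /andP[yW vy]; apply: contra neqHK => /edgeR xy.
have /andP[xW' yW'] : (x \in W) && (y \in W) by rewrite !inE xW yW.
have uy : R u y by rewrite (R_equiv u x y uW xW' yW').2.
apply/eqP/setP=> z; rewrite !inE; case zW: (~~ isolated e z) => //=.
have zW' : z \in W by rewrite inE zW.
have [_ /(_ uy) ->] := R_equiv u y z uW yW' zW'.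
by have [_ /(_ vy) ->] := R_equiv v y z vW yW' zW'.
Qed.

Lemma locally_graded_half_graphs :
  nonempty_isolated e [set: V] \/ half_graphs_and_isolated e.
Proof.
have [W0|W_neq0] := eqVneq W set0; last by right; apply: lg_half_graphs.
left; split; first by rewrite -cards_eq0 cardsT -lt0n.
by move=> v _; have := in_set0 v; rewrite -W0 inE => /negbFE.
Qed.

End LocallyGradedNeighbourhoods.

(** * From half-graphs to extremality *)

Section HalfGraphsExtremal.
Variables (V : finType) (e : rel V).
Hypothesis e_sym : symmetric e.
Implicit Types u v w x y : V.
Notation N := (neighbourhood e).

(** A normal form: swapping the two parts, and reversing the indices where needed, puts [u] on the
    [a] side with a fixed orientation. *)
Lemma half_graph_at (H : {set V}) u : half_graph_on e H -> u \in H ->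
  exists (n : nat) (a b : 'I_n -> V) (k : 'I_n),
    [/\ u = a k, H = a @: 'I_n :|: b @: 'I_n,
        injective a,
        (forall i j, ~~ e (a i) (a j) /\ ~~ e (b i) (b j)) &
        forall i j, e (a i) (b j) = (j <= i)].
Proof.
case=> n [a [b [_ [a_inj b_inj ab] HE noedge eab]]] uH.
have [m [c [d [H' c_inj d_inj ne ecd]]]] : exists (m : nat) (c d : 'I_m -> V),
    [/\ H = c @: 'I_m :|: d @: 'I_m, injective c, injective d,
      (forall i j, ~~ e (c i) (c j) /\ ~~ e (d i) (d j)) &
      forall i j, e (c i) (d j) = (j <= i)].
  case: eab => eab; last by exists n, a, b.
  exists n, b, a; split=> //; first by rewrite setUC.
    by move=> i j; have [] := noedge i j.
  by move=> i j; rewrite e_sym eab.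
move: uH; rewrite H' => /setUP[] /imsetP[k _ ->]; first by exists m, c, d, k.
have rev_im (f : 'I_m -> V) : (f \o @rev_ord m) @: 'I_m = f @: 'I_m.
  apply/setP=> x; apply/imsetP/imsetP => -[i _ ->]; first by exists (rev_ord i).
  by exists (rev_ord i); rewrite //= rev_ordK.
exists m, (d \o @rev_ord m), (c \o @rev_ord m), (rev_ord k); split.
- by rewrite /= rev_ordK.
- by rewrite !rev_im setUC.
- by apply: inj_comp; [exact: d_inj|exact: rev_ord_inj].
- by move=> i j; have [] := ne (rev_ord i) (rev_ord j).
move=> i j; rewrite /= e_sym ecd /=.
by have := ltn_ord i; have := ltn_ord j; lia.
Qed.

(** No edge leaves a piece, so neighbourhoods in the whole graph are the segments seen inside the
    half-graph. *)
Lemma half_graph_neighbourhoods (P : {set {set V}}) (H : {set V}) u :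
    {in P, forall H, half_graph_on e H} ->
    (forall x y, e x y -> y \in cover P) ->
    (forall H K : {set V}, H \in P -> K \in P -> H != K ->
       {in H & K, forall x y, ~~ e x y}) ->
    H \in P -> u \in H ->
  exists (n : nat) (a b : 'I_n -> V) (k : 'I_n),
    [/\ u = a k, injective a, forall i, N (a i) = [set b j | j : 'I_n & j <= i] &
        forall j, N (b j) = [set a i | i : 'I_n & j <= i]].
Proof.
move=> hgP inP sepP HP uH.
have [n [a [b [k [uE HE a_inj ne eab]]]]] := half_graph_at (hgP H HP) uH.
exists n, a, b, k.
have NH x y : x \in H -> e x y -> y \in H.
  move=> xH exy; have /bigcupP[K KP yK] := inP _ _ exy.
  have [<-//|neqHK] := eqVneq K H.
  by rewrite eq_sym in neqHK; have := sepP H K HP KP neqHK x y xH yK; rewrite exy.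
have aH i : a i \in H by rewrite HE in_setU imset_f.
have bH i : b i \in H by rewrite HE in_setU [b i \in b @: _]imset_f ?orbT.
split=> // i; apply/setP=> y; rewrite inE; apply/idP/imsetP.
- move=> ey; have := NH _ _ (aH i) ey; rewrite HE in_setU => /orP[] /imsetP[j _ yE].
    by rewrite yE (negPf (ne i j).1) in ey.
  by exists j; rewrite // inE -eab -yE.
- by case=> j; rewrite inE => ji ->; rewrite eab.
- move=> ey; have := NH _ _ (bH i) ey; rewrite HE in_setU => /orP[] /imsetP[j _ yE].
    by exists j; rewrite // inE -eab -yE e_sym.
  by rewrite yE (negPf (ne i j).2) in ey.
- by case=> j; rewrite inE => ji ->; rewrite e_sym eab.
Qed.

(** The full trace gives two points of a shattered set a common neighbour, so their neighbourhoods
    are nested and one point cannot be cut out without the other. Only singletons and the empty set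
    remain, handled by the other two hypotheses. *)
Lemma nested_extremal : set0 \in neighbourhoods e ->
    (forall u x y, e u x -> e u y -> N x \subset N y \/ N y \subset N x) ->
    (forall x y, e x y -> exists2 u, e u x & N u :\ x \in neighbourhoods e) ->
  extremal (neighbourhoods e).
Proof.
move=> N0 nested rem Y; apply/idP/idP; last exact: strongly_shattered_shattered.
move=> /shatteredP shY; apply/strongly_shatteredP.
have [Y0|[x xY]] := set_0Vmem Y.
  exists set0; rewrite ?sub0set // => Z; rewrite Y0 subset0 => /eqP->.
  by rewrite setU0.
have YE : Y = [set x].
  apply/setP=> y; rewrite in_set1; apply/idP/eqP => [yY|->//].
  apply/eqP/negPn/negP=> neqyx.
  have [_ /imsetP[u _ ->] NuY] := shY Y (subxx _).
  have NY z : z \in Y -> e u z by rewrite -NuY !inE => /andP[].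
  have sep z t : z \in Y -> t \in Y -> t != z -> N z \subset N t -> False.
    move=> zY tY neq zt; have [|_ /imsetP[w _ ->] wY] := shY [set z].
      by rewrite sub1set.
    have : z \in N w :&: Y by rewrite wY set11.
    rewrite !inE => /andP[ewz _].
    have /(subsetP zt) : w \in N z by rewrite inE e_sym.
    rewrite inE e_sym => ewt.
    have : t \in N w :&: Y by rewrite !inE ewt.
    by rewrite wY inE (negPf neq).
  have [] := nested u x y (NY x xY) (NY y yY); first exact: sep.
  by apply: sep => //; rewrite eq_sym.
have [_ /imsetP[w _ ->] wY] := shY Y (subxx _).
have ewx : e w x by move: xY; rewrite -{1}wY !inE => /andP[].
have [u eux uF] : exists2 u, e u x & N u :\ x \in neighbourhoods e.
  by apply: (rem _ w); rewrite e_sym.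
exists (N u :\ x); first by rewrite YE setDE subsetIr.
move=> Z; rewrite YE subset1 => /orP[]/eqP->; last by rewrite set0U.
by rewrite setD1K ?imset_f // inE.
Qed.

Lemma half_graphs_extremal :
  0 < #|V| -> nonempty_isolated e [set: V] \/ half_graphs_and_isolated e ->
  extremal (neighbourhoods e).
Proof.
move=> V_gt0.
have iso0 x y : isolated e x -> e x y = false.
  by rewrite /isolated cards_eq0 => /eqP/setP/(_ y); rewrite !inE.
have iso_set0 x : isolated e x -> set0 \in neighbourhoods e.
  by rewrite /isolated cards_eq0 => /eqP <-; apply: imset_f.
case=> [[/set0Pn[v _] iso]|].
  by apply: nested_extremal => [|u x y|x y];
    [apply: (iso_set0 v); apply: iso|rewrite iso0 ?iso..].
case=> P [I [[_ hgP] [/set0Pn[v vI] isoI] [_ _ coverE] sepP]].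
have inP x y : e x y -> y \in cover P.
  move=> exy; have := in_setT y; rewrite -coverE => /setUP[//|yI].
  by rewrite e_sym iso0 // isoI in exy.
have at_vertex x y : e x y -> exists (n : nat) (a b : 'I_n -> V) (k : 'I_n),
    [/\ y = a k, injective a,
        forall i, N (a i) = [set b j | j : 'I_n & j <= i] &
        forall j, N (b j) = [set a i | i : 'I_n & j <= i]].
  move=> exy; have /bigcupP[H HP yH] := inP _ _ exy.
  exact: half_graph_neighbourhoods sepP HP yH.
have N0 : set0 \in neighbourhoods e by apply: (iso_set0 v); apply: isoI.
apply: nested_extremal => // [u x y eux euy|x y exy].
  have [n [a [b [k [uE _ Na Nb]]]]] := at_vertex x u ltac:(by rewrite e_sym).
  have bE z : e u z -> exists i, z = b i.
    move=> euz; have : z \in N u by rewrite inE.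
    by rewrite uE Na => /imsetP[i _ ->]; exists i.
  have [i ->] := bE x eux; have [j ->] := bE y euy.
  have sub (l m : 'I_n) : l <= m -> N (b m) \subset N (b l).
    move=> lm; rewrite !Nb; apply: imsetS; apply/subsetP=> t; rewrite !inE.
    exact: leq_trans.
  by case: (leqP i j) => [|/ltnW] ij; [right|left]; apply: sub.
have [n [a [b [k [xE a_inj Na Nb]]]]] := at_vertex y x ltac:(by rewrite e_sym).
(* With [x = a k], the set [N (b k)] is the final segment of the [a i] that starts at [x]; deleting
   [x] leaves the next segment. *)
exists (b k); first by rewrite -in_neighbourhood xE Nb imset_f // inE.
have NbD : N (b k) :\ x = [set a i | i : 'I_n & k < i].
  rewrite Nb xE; apply/setP=> z; rewrite in_setD1; apply/andP/imsetP.
    case=> neqz /imsetP[i]; rewrite inE => ki zE; exists i; rewrite // inE.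
    by rewrite ltn_neqAle ki andbT; apply: contraNneq neqz => /val_inj ->; rewrite zE.
  case=> i; rewrite inE => ki ->; split; last by rewrite imset_f // inE ltnW.
  by apply: contraTneq ki => /a_inj ->; rewrite ltnn.
(* The next segment belongs to [b] at [k.+1], or is empty if [k] is the last index; then an isolated
   vertex supplies [set0]. *)
rewrite NbD; have [ltkn|lenk] := ltnP k.+1 n.
  by rewrite -(Nb (Ordinal ltkn)) imset_f.
rewrite [X in X \in _](_ : _ = set0) //; apply/setP=> z; rewrite [RHS]inE.
apply/imsetP=> -[i]; rewrite inE => ki _.
by have := leq_ltn_trans ki (ltn_ord i); rewrite ltnNge lenk.
Qed.

End HalfGraphsExtremal.

Theorem corollary5p8 (V : finType) (e : rel V) (V_nonempty : 0 < #|V|)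
    (e_sym : symmetric e) (e_loopless : irreflexive e) :
  (extremal (neighbourhoods e) <-> well_graded (neighbourhoods e)) /\
  (well_graded (neighbourhoods e) <->
     nonempty_isolated e [set: V] \/ half_graphs_and_isolated e).
Proof.
have ex_wg : extremal (neighbourhoods e) -> well_graded (neighbourhoods e).
  by move=> /extremal_locally_graded; apply: locally_well_graded.
have wg_hg : well_graded (neighbourhoods e) ->
    nonempty_isolated e [set: V] \/ half_graphs_and_isolated e.
  by move=> /well_graded_locally; apply: locally_graded_half_graphs.
have hg_ex := half_graphs_extremal e_sym V_nonempty.
by split; split; auto.
Qed.
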